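(* Let $p=1/2$ and let $W_p=(W_{i,j})_{i,j\ge 0}$ be given by $W_{0,0}=1-p$, $W_{0,1}=p$, $W_{0,j}=0$ for $j\ge 2$, and, for $i\ge1$, $W_{i,i-1}=1-p$, $W_{i,i+1}=p$, and $W_{i,j}=0$ if $j\notin\{i-1,i+1\}$. Then the operator $W_p$ acting on $l^1$ is not supercyclic.
   Context: $l^1$ is the Banach space of complex sequences $(w_n)_{n\ge0}$ with $\|w\|_1=\sum_{n\ge0}|w_n|<\infty$. A matrix acts by $(Wx)_i=\sum_j W_{i,j}x_j$. A bounded linear operator $T$ on a separable complex Banach space $X$ is supercyclic if there is $x\in X$ such that $\{\lambda T^n x : n\in\mathbb{N},\ \lambda\in\mathbb{C}\}$ is dense in $X$. *)

(* Defs.v *)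
From HB Require Import structures.
From mathcomp Require Import all_boot all_order all_algebra.
From mathcomp Require Import complex.
From mathcomp Require Import all_classical all_reals all_analysis.
From mathcomp Require Import ring.
Set Implicit Arguments.
Unset Strict Implicit.
Unset Printing Implicit Defensive.
Import Order.TTheory GRing.Theory Num.Theory.
Import Normc.
Import numFieldNormedType.Exports.
Local Open Scope classical_set_scope.
Local Open Scope ring_scope.
Local Open Scope complex_scope.

Section l1_norm.
Context {R : realType}.
Implicit Types (u v : nat -> R[i]^o) (a : R[i]).

Definition enorm1 u : \bar R := (\sum_(n <oo) (normc (u n))%:E)%E.

Lemma normcC (z : R[i]) : `|z| = (normc z)%:C.
Proof. by case: z. Qed.

Lemma normc_ge0 (z : R[i]) : 0 <= normc z.
Proof. by case: z => a b; exact: sqrtr_ge0. Qed.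

Lemma normcD_le (y z : R[i]) : normc (y + z) <= normc y + normc z.
Proof. by rewrite -lecR rmorphD /= -!normcC ler_normD. Qed.

Lemma normc_real (x : R) : normc x%:C = `|x|.
Proof. by rewrite /normc /= expr0n /= addr0 sqrtr_sqr. Qed.

Lemma enorm1_ge0 u : (0 <= enorm1 u)%E.
Proof. by apply: nneseries_ge0 => n _ _; rewrite lee_fin normc_ge0. Qed.

Lemma enorm1_ge_sum u N : ((\sum_(n < N) normc (u n))%:E <= enorm1 u)%E.
Proof.
rewrite -sumEFin; apply: le_trans (nneseries_lim_ge N _); last first.
  by move=> n _ _; rewrite lee_fin normc_ge0.
by rewrite big_mkord.
Qed.

Lemma enorm1_le u (M : R) :
  (forall N, \sum_(n < N) normc (u n) <= M) -> (enorm1 u <= M%:E)%E.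
Proof.
move=> uM; apply: lime_le.
  by apply: is_cvg_nneseries => n _ _; rewrite lee_fin normc_ge0.
by apply: nearW => N; rewrite big_mkord sumEFin lee_fin.
Qed.

Lemma enorm1D u v : (enorm1 (u + v)%R <= enorm1 u + enorm1 v)%E.
Proof.
rewrite /enorm1 -nneseriesD; last 2 first.
- by move=> n _ _; rewrite lee_fin normc_ge0.
- by move=> n _ _; rewrite lee_fin normc_ge0.
apply: lee_nneseries => [n _ _|n _]; first by rewrite lee_fin normc_ge0.
by rewrite -EFinD lee_fin normcD_le.
Qed.

Lemma enorm1Z a u : (enorm1 (a *: u) = (normc a)%:E * enorm1 u)%E.
Proof.
rewrite /enorm1 -nneseriesZl; last by move=> n _; rewrite lee_fin normc_ge0.
by apply: eq_eseriesr => n _; rewrite -EFinM; congr EFin; exact: normcM.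
Qed.

Definition l1_pred : {pred nat -> R[i]^o} := mem [set u | (enorm1 u < +oo)%E].

Lemma l1_predP u : (u \in l1_pred) <-> (enorm1 u < +oo)%E.
Proof. by rewrite /l1_pred inE. Qed.

Lemma l1_submod_closed : submod_closed l1_pred.
Proof.
split=> [|a u v].
  apply/l1_predP; apply: (@le_lt_trans _ _ 0%:E); last exact: ltry.
  by apply: enorm1_le => N; rewrite big1 // => n _; exact: normc0.
move=> /l1_predP u1 /l1_predP v1; apply/l1_predP.
apply: le_lt_trans (enorm1D _ _) _; apply: lte_add_pinfty => //.
rewrite enorm1Z lte_mul_pinfty // ?lee_fin ?normc_ge0 //.
Qed.

HB.instance Definition _ :=
  GRing.isSubmodClosed.Build R[i] (nat -> R[i]^o) l1_pred l1_submod_closed.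

End l1_norm.

Record l1 (R : realType) := L1 {
  seq_of_l1 :> nat -> R[i]^o;
  seq_of_l1P : seq_of_l1 \in l1_pred }.

Section l1_space.
Context (R : realType).

HB.instance Definition _ := [isSub for @seq_of_l1 R].
HB.instance Definition _ := [Choice of l1 R by <:].
HB.instance Definition _ := [SubChoice_isSubLmodule of l1 R by <:].

Implicit Types (x y : l1 R).

Definition norm1 x : R := fine (enorm1 x).

Lemma norm1E x : ((norm1 x)%:E = enorm1 x)%E.
Proof.
rewrite fineK // ge0_fin_numE ?enorm1_ge0 //.
by apply/l1_predP; exact: seq_of_l1P.
Qed.

(* [normedModType R[i]] requires a norm with values in R[i]. *)
Definition l1_norm x : R[i] := (norm1 x)%:C.

Lemma l1_normD x y : l1_norm (x + y) <= l1_norm x + l1_norm y.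
Proof.
rewrite /l1_norm -rmorphD /= lecR -lee_fin EFinD !norm1E; exact: enorm1D.
Qed.

Lemma l1_normZ (a : R[i]) x : l1_norm (a *: x) = `|a| * l1_norm x.
Proof.
rewrite /l1_norm normcC -rmorphM; congr (_%:C); apply: EFin_inj.
by rewrite EFinM !norm1E -enorm1Z.
Qed.

Lemma normc_le_norm1 x n : normc (x n) <= norm1 x.
Proof.
rewrite -lee_fin norm1E; apply: le_trans (enorm1_ge_sum _ n.+1).
rewrite lee_fin big_ord_recr /= lerDr sumr_ge0 // => k _.
exact: normc_ge0.
Qed.

Lemma l1_norm0_eq0 x : l1_norm x = 0 -> x = 0.
Proof.
move=> /complexI x0; apply: val_inj; apply/funext => n /=.
by apply: eq0_normc; apply: le_anti; rewrite normc_ge0 -x0 normc_le_norm1.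
Qed.

HB.instance Definition _ :=
  Lmodule_isNormed.Build R[i] (l1 R) l1_normD l1_normZ l1_norm0_eq0.

Lemma l1_normE x : `|x| = (norm1 x)%:C.
Proof. by []. Qed.

Lemma ball_l1P x y (e : R) : ball x e%:C y <-> norm1 (x - y) < e.
Proof. by rewrite -ball_normE /ball_ /= l1_normE ltcR. Qed.

Lemma normRe_le (z : R[i]) : `|complex.Re z| <= normc z.
Proof. by rewrite -lecR -normcC normc_ge_Re. Qed.

Lemma normIm_le (z : R[i]) : `|complex.Im z| <= normc z.
Proof.
by case: z => a b; rewrite /normc /= -sqrtr_sqr ler_wsqrtr // lerDr sqr_ge0.
Qed.

Lemma normc_le_ReIm (z : R[i]) : normc z <= `|complex.Re z| + `|complex.Im z|.
Proof.
rewrite {1}[z]complexE; apply: le_trans (normcD_le _ _) _.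
by rewrite normcM !normc_real /normc /= expr0n expr1n add0r sqrtr1 mul1r.
Qed.

Lemma l1_complete (F : set_system (l1 R)) :
  ProperFilter F -> cauchy F -> cvg F.
Proof.
move=> FF /cauchyP Fc.
have coord (f : R[i]^o -> R) n : {morph f : y z / y - z} ->
    (forall z, `|f z| <= normc z) ->
    (fun w : l1 R => f (w n)) @ F --> lim ((fun w : l1 R => f (w n)) @ F).
  move=> fB f_le; apply: cauchy_cvg; apply/cauchyP => e e0.
  have [|x Fx] := Fc e%:C; first by rewrite ltcR.
  exists (f (x n)); apply: (@filterS _ F _ _ _ _ Fx) => y /ball_l1P xy.
  rewrite /=; change (`|f (x n) - f (y n)| < e).
  apply: le_lt_trans xy; apply: le_trans (normc_le_norm1 (x - y) n).
  by apply: le_trans (f_le _); rewrite -[(x - y) n]/(x n - y n) fB.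
pose w n : R[i]^o := lim ((fun v : l1 R => complex.Re (v n)) @ F)
  +i* lim ((fun v : l1 R => complex.Im (v n)) @ F).
have w_near N (d : R) : 0 < d ->
    F [set v : l1 R | forall n : 'I_N, normc (v n - w n) < d].
  move=> d0; apply: filter_forall => n.
  have d2 : 0 < d / 2 by rewrite divr_gt0.
  have /cvgrPdist_lt/(_ _ d2) Ren := coord (@complex.Re R) n (raddfB _) normRe_le.
  have /cvgrPdist_lt/(_ _ d2) Imn := coord (@complex.Im R) n (raddfB _) normIm_le.
  near=> v; apply: le_lt_trans (normc_le_ReIm _) _.
  rewrite [d]splitr -normrN -[X in _ + X]normrN; apply: ltrD.
  - by rewrite raddfB opprB /=; near: v.
  - by rewrite raddfB opprB /=; near: v.
have xw_le x (e : R) : F (ball x e%:C) -> forall N,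
    \sum_(n < N) normc (x n - w n) <= e.
  move=> Fx N; apply/ler_addgt0Pr => d d0.
  have dN : 0 < d / N.+1%:R by rewrite divr_gt0.
  have [v [/ball_l1P xv vw]] := filter_ex (filterI Fx (w_near N _ dN)).
  apply: (@le_trans _ _ (\sum_(n < N) normc ((x - v) n)
                         + \sum_(n < N) normc (v n - w n))).
    rewrite -big_split /=; apply: ler_sum => n _.
    by apply: le_trans (normcD_le _ _); rewrite addrA subrK.
  apply: lerD.
    rewrite -lee_fin; apply: le_trans (enorm1_ge_sum _ _) _.
    by rewrite -norm1E lee_fin ltW.
  apply: (@le_trans _ _ (\sum_(n < N) d / N.+1%:R)).
    by apply: ler_sum => n _; exact: ltW.
  rewrite sumr_const card_ord -[_ *+ N]mulr_natr mulrAC ler_pdivrMr //.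
  by rewrite ler_pM2l // ler_nat.
have w1 : w \in l1_pred.
  have [|x Fx] := Fc 1%:C; first by rewrite ltcR.
  have -> : w = seq_of_l1 x - (seq_of_l1 x - w) by rewrite opprB addrC subrK.
  apply: rpredB; first exact: seq_of_l1P.
  by apply/l1_predP; apply: le_lt_trans (enorm1_le (xw_le _ _ Fx)) (ltry _).
apply/cvg_ex; exists (L1 w1); apply/cvgrPdist_lt => e' e'0.
have [e e0 ->] : exists2 e : R, 0 < e & e' = e%:C.
  exists (complex.Re e'); first by case: e' e'0 => a b /=; rewrite ltcE /= => /andP[].
  by case: e' e'0 => a b /=; rewrite ltcE /= => /andP[/eqP ->].
have [|x Fx] := Fc (e / 2)%:C; first by rewrite ltcR divr_gt0.
near=> v.
have -> : L1 w1 - v = (x - v) - (x - L1 w1).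
  by rewrite opprB [RHS]addrC addrA subrK.
apply: le_lt_trans (ler_normB _ _) _; rewrite !l1_normE -rmorphD ltcR [e]splitr.
apply: ltr_leD; first by apply/ball_l1P; near: v.
rewrite -lee_fin norm1E; apply: enorm1_le; exact: (xw_le x).
Unshelve. all: by end_near. Qed.

HB.instance Definition _ := Uniform_isComplete.Build (l1 R) l1_complete.

End l1_space.

(* A bounded operator is a continuous linear map; [walk_op_continuous] below is
   the continuity of the operator to which this is applied. *)
Definition supercyclic (R : realType) (X : completeNormedModType R[i])
    (T : {linear X -> X}) : Prop :=
  exists x : X, dense [set y | exists (l : R[i]) (n : nat), y = l *: iter n T x].

(* Row i of W x is the (possibly infinite) sum of the W i j * x j. *)
Definition mx_act (R : realType) (W : nat -> nat -> R[i]) (x : nat -> R[i]^o) :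
    nat -> R[i]^o :=
  fun i => limn (series (fun j => W i j * x j : R[i]^o)).

(* The matrix W_p; the entries are real numbers embedded into R[i]. *)
Definition walk_mx (R : realType) (p : R) (i j : nat) : R[i] :=
  (if i is i'.+1 then
     if j == i' then 1 - p else if j == i'.+2 then p else 0
   else
     if j == 0%N then 1 - p else if j == 1%N then p else 0)%:C.

Section walk_operator.
Context (R : realType) (p : R).

Lemma mx_act_finite (W : nat -> nat -> R[i]) (x : nat -> R[i]^o) i N :
  (forall j, (N <= j)%N -> W i j = 0) ->
  mx_act W x i = \sum_(j < N) W i j * x j.
Proof.
move=> W0; apply: lim_near_cst; first exact: norm_hausdorff.
near=> n; have Nn : (N <= n)%N by near: n; exists N.
rewrite /series /= -(big_mkord xpredT (fun j => W i j * x j)).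
rewrite (big_cat_nat _ Nn) //= [X in _ + X]big_nat_cond [X in _ + X]big1 ?addr0 //.
by move=> j; rewrite andbT => /andP[Nj _]; rewrite W0 // mul0r.
Unshelve. all: by end_near. Qed.

Lemma walk_act0 (x : nat -> R[i]^o) :
  mx_act (walk_mx p) x 0 = (1 - p)%:C * x 0%N + p%:C * x 1%N.
Proof.
rewrite (@mx_act_finite _ _ _ 2); last by move=> [|[|j]].
by rewrite !big_ord_recr big_ord0 /= add0r.
Qed.

Lemma walk_actS (x : nat -> R[i]^o) i :
  mx_act (walk_mx p) x i.+1 = (1 - p)%:C * x i + p%:C * x i.+2.
Proof.
rewrite (@mx_act_finite _ _ _ i.+3); last first.
  by move=> j ij; rewrite /walk_mx !gtn_eqF // ltnW // ltnW.
rewrite !big_ord_recr /= big1 ?add0r => [|j _].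
  rewrite /walk_mx eqxx [(_.+2 == i)]gtn_eqF // eqxx.
  by rewrite [(_.+1 == i)]gtn_eqF // ltn_eqF // mul0r addr0.
move: (ltn_ord j) => ji; rewrite /walk_mx (ltn_eqF ji) ltn_eqF ?mul0r //.
by rewrite ltnS ltnW // ltnW.
Qed.

Lemma walk_act_le (x : l1 R) :
  (enorm1 (mx_act (walk_mx p) x)
     <= (`|1 - p| * (norm1 x + norm1 x) + `|p| * norm1 x)%:E)%E.
Proof.
apply: enorm1_le => N.
have xsum M : \sum_(n < M) normc (x n) <= norm1 x.
  by rewrite -lee_fin norm1E; exact: enorm1_ge_sum.
apply: (@le_trans _ _ (\sum_(i < N)
    (`|1 - p| * normc (x i.-1) + `|p| * normc (x i.+1)))).
  apply: ler_sum => -[[|i] iN] _ /=; rewrite ?walk_act0 ?walk_actS;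
  by apply: le_trans (normcD_le _ _) _; rewrite !normcM !normc_real.
rewrite big_split /= -!mulr_sumr; apply: lerD; apply: ler_wpM2l => //.
  have norm1_ge0 : 0 <= norm1 x by apply: le_trans (xsum 0%N); rewrite big_ord0.
  case: N => [|N]; first by rewrite big_ord0 addr_ge0.
  rewrite big_ord_recl /=; apply: lerD; first exact: normc_le_norm1.
  exact: xsum.
apply: le_trans (xsum N.+1); rewrite big_ord_recl /= lerDr; exact: normc_ge0.
Qed.

Lemma walk_act_l1 (x : l1 R) : mx_act (walk_mx p) x \in l1_pred.
Proof. by apply/l1_predP; apply: le_lt_trans (walk_act_le x) (ltry _). Qed.

Definition walk_op (x : l1 R) : l1 R := L1 (walk_act_l1 x).

Lemma walk_op_linear : linear walk_op.
Proof.
move=> a x y; apply: val_inj; apply/funext => -[|i].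
  rewrite -[LHS]/(mx_act (walk_mx p) (a *: x + y) 0).
  rewrite -[RHS]/(a * mx_act (walk_mx p) x 0 + mx_act (walk_mx p) y 0).
  rewrite !walk_act0.
  rewrite -![(a *: x + y) _]/(a * x _ + y _); ring.
rewrite -[LHS]/(mx_act (walk_mx p) (a *: x + y) i.+1).
rewrite -[RHS]/(a * mx_act (walk_mx p) x i.+1 + mx_act (walk_mx p) y i.+1).
rewrite !walk_actS.
rewrite -![(a *: x + y) _]/(a * x _ + y _); ring.
Qed.

HB.instance Definition _ :=
  GRing.isLinear.Build R[i] (l1 R) (l1 R) _ walk_op walk_op_linear.

Lemma walk_op_continuous : continuous walk_op.
Proof.
apply: (@bounded_linear_continuous _ _ _ walk_op); apply/linear_boundedP.
exists (`|1 - p| *+ 2 + `|p|)%:C; split.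
  by apply: ger0_real; rewrite lecR addr_ge0 // mulrn_wge0.
move=> r /ltW rM x; apply: le_trans (ler_wpM2r (normr_ge0 x) rM).
rewrite !l1_normE -rmorphM lecR -lee_fin norm1E.
apply: le_trans (walk_act_le x) _; rewrite lee_fin.
by rewrite mulrDl mulr2n mulrDl mulrDr.
Qed.

End walk_operator.

(* Main.v *)
(** The symmetric reflecting walk is a contraction of [l^1] preserving the sum
of the coordinates.  If [x] were supercyclic, approximating [3 e_0] by
[l0 *: W^n0 x] bounds the sum of [x] away from 0; approximating
[M (e_0 - e_1)] by [l *: W^n x], whose sum is then small, bounds [|l|] by
[2 |l0|], hence [2 M - 1 <= |l| ||x|| <= 2 |l0| ||x||] with [M] arbitrary.
The sum of [x] is handled through its partial sums, which avoids defining the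
limit. *)
Require Import Defs.
From mathcomp Require Import all_boot all_order all_algebra.
From mathcomp Require Import complex.
From mathcomp Require Import all_classical all_reals all_analysis.
From mathcomp Require Import ring lra.
Set Implicit Arguments.
Unset Strict Implicit.
Unset Printing Implicit Defensive.
Import Order.TTheory GRing.Theory Num.Theory.
Import Normc.
Import numFieldNormedType.Exports.
Local Open Scope classical_set_scope.
Local Open Scope ring_scope.
Local Open Scope complex_scope.

(** As [0.-1 = 0], the left neighbours sum to the total plus [a 0 - a N], the right ones to the
    total plus [a N.+1 - a 0]; the [a 0] terms cancel. *)
Lemma sum_reflected_neighbours (V : zmodType) (a : nat -> V) N :
  \sum_(i < N.+1) (a i.-1 + a i.+1) =
  (\sum_(i < N.+1) a i) *+ 2 + (a N.+1 - a N).
Proof.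
elim: N => [|N IH]; first by rewrite !big_ord1 mulr2n addrACA subrr addr0.
rewrite big_ord_recr IH [in RHS]big_ord_recr mulrnDl.
rewrite -[LHS]addrA -[RHS]addrA; congr (_ + _).
rewrite /= mulr2n -[RHS]addrA -[LHS]addrA; congr (_ + _).
by rewrite addKr addrCA subrr addr0.
Qed.

Section l1_sums.
Context (R : realType).
Implicit Types (x y : l1 R) (N : nat).

Definition psum N x : R[i] := \sum_(n < N) x n.

Lemma psumB N x y : psum N (x - y) = psum N x - psum N y.
Proof. by rewrite /psum -sumrB. Qed.

Lemma psumZ N (l : R[i]) x : psum N (l *: x) = l * psum N x.
Proof. by rewrite /psum mulr_sumr. Qed.

Lemma sum_normc_le_norm1 N x : \sum_(n < N) normc (x n) <= norm1 x.
Proof. by rewrite -lee_fin norm1E; exact: enorm1_ge_sum. Qed.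

Lemma norm1_ge0 x : 0 <= norm1 x.
Proof. by apply: le_trans (sum_normc_le_norm1 0 x); rewrite big_ord0. Qed.

Lemma norm1_le x (M : R) :
  (forall N, \sum_(n < N) normc (x n) <= M) -> norm1 x <= M.
Proof. by move=> xM; rewrite -lee_fin norm1E; exact: enorm1_le. Qed.

Lemma norm1D_le x y : norm1 (x + y) <= norm1 x + norm1 y.
Proof. by rewrite -lecR rmorphD; exact: l1_normD. Qed.

Lemma norm1Z (l : R[i]) x : norm1 (l *: x) = normc l * norm1 x.
Proof. by apply: complexI; rewrite rmorphM [RHS]/= -normcC; exact: l1_normZ. Qed.

Lemma normc_psum_le N x : normc (psum N x) <= norm1 x.
Proof.
apply: le_trans (sum_normc_le_norm1 N x); rewrite /psum.
elim/big_ind2: _ => [|a b c d ab cd|//]; first by rewrite normc0.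
exact: le_trans (normcD_le _ _) (lerD ab cd).
Qed.

(** Makes the boundary term of a truncated sum negligible. *)
Lemma l1_cvg0 x : (fun n => normc (x n)) @ \oo --> (0 : R).
Proof.
apply: cvg_series_cvg_0; apply: nondecreasing_is_cvgn.
  by apply/nondecreasing_seqP => n; rewrite /series /= big_nat_recr //= lerDl normc_ge0.
exists (norm1 x) => _ [N _ <-].
by rewrite /series /= big_mkord sum_normc_le_norm1.
Qed.

Definition two_point_seq (a b : R[i]) (n : nat) : R[i]^o :=
  if n is n'.+1 then if n' is 0 then b else 0 else a.

Lemma two_point_seq_l1 (a b : R[i]) : two_point_seq a b \in l1_pred.
Proof.
apply/l1_predP; apply: (@le_lt_trans _ _ (normc a + normc b)%:E); last exact: ltry.
apply: enorm1_le => -[|[|N]].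
- by rewrite big_ord0 addr_ge0 ?normc_ge0.
- by rewrite big_ord1 lerDl normc_ge0.
- by rewrite !big_ord_recl /= big1 ?addr0 // => i _; exact: normc0.
Qed.

Definition two_point (a b : R[i]) : l1 R := L1 (two_point_seq_l1 a b).

Lemma norm1_two_point (a b : R[i]) : normc a + normc b <= norm1 (two_point a b).
Proof.
by apply: le_trans (sum_normc_le_norm1 2 _); rewrite !big_ord_recl big_ord0 addr0.
Qed.

Lemma psum_two_point (a b : R[i]) N : psum N.+2 (two_point a b) = a + b.
Proof. by rewrite /psum !big_ord_recl big1 ?addr0. Qed.

End l1_sums.

Section symmetric_walk.
Context (R : realType).
Local Notation W := (@walk_op R (1 / 2)).
Implicit Types (x : l1 R) (N n : nat).

(** The convention [0.-1 = 0] is exactly the reflection at 0, so row 0 needs no separate formula. *)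
Lemma walk_half x i : W x i = (1 / 2 : R)%:C * (x i.-1 + x i.+1).
Proof.
have h : 1 - 1 / 2 = 1 / 2 :> R by lra.
by case: i => [|i]; [rewrite [LHS]walk_act0|rewrite [LHS]walk_actS]; rewrite h mulrDr.
Qed.

Lemma norm1_walk_le x : norm1 (W x) <= norm1 x.
Proof.
apply: norm1_le => -[|N]; first by rewrite big_ord0 norm1_ge0.
apply: (@le_trans _ _
    (\sum_(i < N.+1) (1 / 2) * (normc (x i.-1) + normc (x i.+1)))).
  apply: ler_sum => i _; rewrite walk_half normcM normc_real ger0_norm //.
  by rewrite ler_wpM2l // normcD_le.
(* The bound becomes the mean of the partial sums of lengths [N] and [N.+2], each at most
   [norm1 x]. *)
rewrite -mulr_sumr (sum_reflected_neighbours (fun n => normc (x n))).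
have := sum_normc_le_norm1 N.+2 x; have := sum_normc_le_norm1 N x.
rewrite !big_ord_recr /=; lra.
Qed.

Lemma norm1_iter_walk_le n x : norm1 (iter n W x) <= norm1 x.
Proof. by elim: n => //= n; exact: le_trans (norm1_walk_le _). Qed.

(** Mass is conserved except for the flow across the truncation point. *)
Lemma psum_walk N x :
  psum N.+1 (W x) - psum N.+1 x = (1 / 2 : R)%:C * (x N.+1 - x N).
Proof.
have h2 : (1 / 2 : R)%:C * 2 = 1.
  by rewrite -(rmorph_nat (real_complex R)) -rmorphM /= divfK ?pnatr_eq0.
rewrite /psum (eq_bigr _ (fun (i : 'I_N.+1) _ => walk_half x i)) -mulr_sumr.
rewrite (sum_reflected_neighbours x) mulrDr -[(\sum_(_ < _) _) *+ 2]mulr_natr mulrCA.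
by rewrite h2 mulr1 addrAC subrr add0r.
Qed.

Lemma psum_iter_walk n x (e : R) : 0 < e ->
  \forall N \near \oo, normc (psum N (iter n W x) - psum N x) < e.
Proof.
elim: n e => [|n IH] e e0; first by apply: nearW => N; rewrite subrr normc0.
have e2 : 0 < e / 2 by rewrite divr_gt0.
set y := iter n W x in IH *.
have [K _ yK] : \forall N \near \oo, normc (y N) < e / 2.
  have /cvgrPdist_lt/(_ _ e2) := l1_cvg0 y; apply: filterS => N.
  by rewrite sub0r normrN ger0_norm ?normc_ge0.
(* Both coordinates in the boundary term, [N'] and [N'.+1], must lie beyond [K]; half their
   difference is then below [e / 2]. *)
near=> N; have [N' NN' KN'] : exists2 N', N = N'.+1 & (K <= N')%N.
  have : (K < N)%N by near: N; exists K.+1.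
  by case: (N) => // N' ?; exists N'.
have -> : psum N (iter n.+1 W x) - psum N x =
    (psum N (W y) - psum N y) + (psum N y - psum N x) by rewrite addrA subrK.
apply: le_lt_trans (normcD_le _ _) _.
have : normc (psum N y - psum N x) < e / 2 by near: N; exact: IH.
rewrite NN' psum_walk normcM normc_real ger0_norm //.
have := normcD_le (y N'.+1) (- y N').
have -> : normc (- y N') = normc (y N').
  by apply: complexI; rewrite -!normcC normrN.
have := yK _ KN'; have := yK _ (leqW KN'); lra.
Unshelve. all: by end_near. Qed.

Lemma supercyclic_approx x (y : l1 R) :
  dense [set y | exists (l : R[i]) n, y = l *: iter n W x] ->
  exists (l : R[i]) n, norm1 (l *: iter n W x - y) < 1.
Proof.
move=> xd; have [|z [/= yz [l [n zE]]]] := xd (ball y 1%:C) _ (ball_open _ _).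
  by exists y; apply: ballxx; rewrite ltcR.
by exists l, n; move/ball_sym/ball_l1P: yz; rewrite zE.
Qed.

Lemma psum_near_approx x (y : l1 R) (l : R[i]) n :
  norm1 (l *: iter n W x - y) < 1 ->
  \forall N \near \oo, normc (l * psum N x - psum N y) < 2.
Proof.
move=> xy.
(* The tolerance [1 / (normc l + 1)] makes sense even for [l = 0] and keeps the drift of the sum,
   multiplied by [l], below 1; the approximation error contributes the other 1. *)
have l1_gt0 : 0 < normc l + 1 by rewrite ltr_wpDl // normc_ge0.
have := psum_iter_walk n x (divr_gt0 ltr01 l1_gt0).
apply: filterS => N; rewrite ltr_pdivlMr //.
set d := _ - psum N x => dl.
have -> : l * psum N x - psum N y =
    psum N (l *: iter n W x - y) + (- l) * d.
  by rewrite /d psumB psumZ; ring.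
apply: le_lt_trans (normcD_le _ _) _.
have := le_lt_trans (normc_psum_le N _) xy; rewrite normcM.
have -> : normc (- l) = normc l by apply: complexI; rewrite -!normcC normrN.
have := normc_ge0 d; have := normc_ge0 l; nra.
Qed.

End symmetric_walk.

Theorem proposition4p6 (R : realType) :
  ~ supercyclic (walk_op (1 / 2 : R) : {linear l1 R -> l1 R}).
Proof.
case=> x xd.
(* The sum 3 exceeds the error bound 2 by 1, which gives [s_ge] below. *)
have [l0 [n0 near0]] := supercyclic_approx (two_point 3%:C 0) xd.
pose M : R := normc l0 * norm1 x + 1.
have [l [n near1]] := supercyclic_approx (two_point M%:C (- M)%:C) xd.
have M0 : 0 <= M by rewrite addr_ge0 // mulr_ge0 ?normc_ge0 ?norm1_ge0.
have large : \forall N \near \oo, (2 <= N)%N by exists 2.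
(* One truncation, containing both target supports, serves the two approximations, so the same
   partial sum [s] appears in each. *)
have [[|[|N]] [[S0 S1] //]] :=
  filter_ex (filterI (filterI (psum_near_approx near0) (psum_near_approx near1)) large).
move=> _; move: S0 S1; rewrite !psum_two_point addr0 -rmorphD subrr subr0.
set s := psum _ _ => S0; rewrite normcM => S1.
have s_ge : 1 < normc l0 * normc s.
  have : normc 3%:C <= normc (l0 * s) + normc (3%:C - l0 * s).
    by apply: le_trans (normcD_le _ _); rewrite addrC subrK.
  have -> : normc (3%:C - l0 * s) = normc (l0 * s - 3%:C).
    by apply: complexI; rewrite -!normcC distrC.
  rewrite normc_real ger0_norm // normcM; lra.
(* Multiply [normc l * normc s < 2] by [normc l0] and use [s_ge]. *)
have l_le : normc l <= 2 * normc l0.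
  have := normc_ge0 l0; have := normc_ge0 l; nra.
have : 2 * M - 1 <= normc l * norm1 x.
  have : M + M <= norm1 (two_point M%:C (- M)%:C).
    apply: le_trans (norm1_two_point _ _).
    by rewrite !normc_real normrN ger0_norm.
  have := norm1D_le (l *: iter n (walk_op (1 / 2)) x)
            (- (l *: iter n (walk_op (1 / 2)) x - two_point M%:C (- M)%:C)).
  rewrite opprB addrC subrK.
  have -> : norm1 (two_point M%:C (- M)%:C - l *: iter n (walk_op (1 / 2)) x) =
    norm1 (l *: iter n (walk_op (1 / 2)) x - two_point M%:C (- M)%:C).
    by apply: complexI; rewrite -!l1_normE distrC.
  rewrite norm1Z; have := norm1_iter_walk_le n x; have := normc_ge0 l; nra.
(* By the choice of [M], the left side is [2 * normc l0 * norm1 x + 1], one more than [l_le]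
   allows. *)
have := norm1_ge0 x; rewrite /M; nra.
Qed.
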